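(* Let $P$ be a strongly connected poset, and let $A$ and $B$ be distinct antichain cutsets of $P$. Then $A\cap B=\emptyset$.
   Context: A maximal chain of a poset is a chain not properly contained in any other chain. An antichain cutset of a poset $P$ is a set of elements of $P$ that intersects each maximal chain of $P$ in exactly one element. A poset $P$ is strongly connected if for any two maximal chains $\mathbf{c},\mathbf{d}$ of $P$ there is a finite sequence of maximal chains $\mathbf{c}=\mathbf{c}^{(0)},\mathbf{c}^{(1)},\dots,\mathbf{c}^{(n)}=\mathbf{d}$ such that the symmetric difference of $\mathbf{c}^{(i)}$ and $\mathbf{c}^{(i+1)}$ has cardinality two for each $i$. No finiteness, discreteness or gradedness of $P$ is assumed. *)

(* Defs.v *)
From mathcomp Require Import all_boot all_order.
From mathcomp Require Import boolp classical_sets functions cardinality.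
Set Implicit Arguments.
Unset Strict Implicit.
Unset Printing Implicit Defensive.

Local Open Scope classical_set_scope.
Local Open Scope card_scope.
Local Open Scope order_scope.

Section PosetChains.
Context (d : Order.disp_t) (P : porderType d).
Implicit Types A C D : set P.

Definition is_chain C := total_on C (fun x y => x <= y).

Definition maximal_chain C :=
  is_chain C /\ forall D, is_chain D -> ~ (C `<` D).

Definition antichain_cutset A :=
  forall C, maximal_chain C -> exists! x, (A `&` C) x.

(* The sequence c(0), ..., c(n) is the restriction to indices at most n of a
   function on nat; n = 0 is allowed. [`+`] is symmetric difference. *)
Definition strongly_connected :=
  forall C D, maximal_chain C -> maximal_chain D ->
    exists (n : nat) (c : nat -> set P),
      [/\ c 0%N = C, c n = D,
          forall i : nat, (i <= n)%N -> maximal_chain (c i) &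
          forall i : nat, (i < n)%N -> (c i `+` c i.+1) #= `I_2].

End PosetChains.

Arguments strongly_connected {d} P.

(* Main.v *)
Require Import Defs.
From mathcomp Require Import all_boot all_order.
From mathcomp Require Import boolp classical_sets functions cardinality.

Local Open Scope classical_set_scope.

(** Along a path of maximal chains, the property that A and B meet the chain in
the same point persists: when that common point z is removed, the unique new
element is the only one which can lie in A or in B.  So if A and B meet, their
points agree on every maximal chain, and every element lies on one by Zorn. *)

Lemma card_eq_I2_pigeonhole {T : Type} {S : set T} {x y z : T} :
  (S #= `I_2)%card -> S x -> S y -> S z -> [\/ x = y, y = z | x = z].
Proof.
move=> /card_set_bijP[f [fS finj _]] Sx Sy Sz.
have inj u v : S u -> S v -> f u = f v -> u = v.
  by move=> Su Sv; apply: finj; rewrite inE.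
have := fS _ Sx; have := fS _ Sy; have := fS _ Sz => /=.
(* Three values in $\{0,1\}$: two of them agree, and [f] is injective on [S]. *)
case fz: (f z) => [|[|?]] // _; case fy: (f y) => [|[|?]] // _;
  case fx: (f x) => [|[|?]] // _;
  by [apply: Or31; apply: inj; rewrite ?fx ?fy
     |apply: Or32; apply: inj; rewrite ?fy ?fz
     |apply: Or33; apply: inj; rewrite ?fx ?fz].
Qed.

Section CutsetsAlongChains.
Context (d : Order.disp_t) (P : porderType d).
Implicit Types A B C D : set P.

(** Zorn is applied to the sets that form a chain once [w] is added, not to the chains through [w]:
    this family also contains the union of the empty subfamily. *)
Lemma exists_maximal_chain (w : P) : exists2 C, maximal_chain C & C w.
Proof.
have [F chainF totF|M [chainM maxM]] :=
    @Zorn_bigcup P [set C | is_chain (w |` C)].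
  have {}chainF X : F X -> is_chain (w |` X) by exact: chainF.
  move=> x y [->|[X FX Xx]] [->|[Y FY Yy]].
  - by left.
  - by apply: (chainF _ FY); [left | right].
  - by apply: (chainF _ FX); [right | left].
  - have [XY|YX] := totF _ _ FX FY.
    + by apply: (chainF _ FY); right => //; apply: XY.
    + by apply: (chainF _ FX); right => //; apply: YX.
exists (w |` M); last by left.
split=> // D chainD [wMD DwM]; apply: (maxM D).
  split=> [x Mx|DM]; first by apply: wMD; right.
  by apply: DwM => x /DM; right.
(* As [w] already lies in [D], adding it changes nothing. *)
by rewrite /= setUidr // => _ ->; apply: wMD; left.
Qed.

Lemma antichain_cutset_uniq {A C} {x y : P} :
  antichain_cutset A -> maximal_chain C -> A x -> C x -> A y -> C y -> x = y.
Proof.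
by move=> cutA /cutA[a [_ aU]] Ax Cx Ay Cy; rewrite -(aU x) // -(aU y).
Qed.

Lemma common_point_step {A B C D} :
  antichain_cutset A -> antichain_cutset B ->
  maximal_chain C -> maximal_chain D -> (C `+` D #= `I_2)%card ->
  A `&` B `&` C !=set0 -> A `&` B `&` D !=set0.
Proof.
move=> cutA cutB maxC maxD cardCD [z [[Az Bz] Cz]].
have [Dz|nDz] := pselect (D z); first by exists z.
(* To be used for both [A] and [B]. The point of [A'] on [D] is not in [C], where [A'] has only [z],
   which [D] misses. *)
have new A' : antichain_cutset A' -> A' z -> exists y, [/\ A' y, D y & ~ C y].
  move=> cutA' A'z; have [y [[A'y Dy] _]] := cutA' _ maxD.
  exists y; split=> // Cy; apply: nDz.
  by rewrite (antichain_cutset_uniq cutA' maxC A'z Cz A'y Cy).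
have [[a [Aa Da nCa]] [b [Bb Db nCb]]] := (new _ cutA Az, new _ cutB Bz).
(* [a] and [b] lie in [D] but not in [C], [z] in [C] but not in [D]: all three belong to a set of
   two elements. *)
have [ab|bz|az] : [\/ a = b, b = z | a = z].
- by apply: (card_eq_I2_pigeonhole cardCD); [right | right | left].
- by exists a; split=> //; split=> //; rewrite ab.
- by case: nCb; rewrite bz.
- by case: nCa; rewrite az.
Qed.

Lemma common_point_transfer {A B C D} :
  strongly_connected P -> antichain_cutset A -> antichain_cutset B ->
  maximal_chain C -> maximal_chain D ->
  A `&` B `&` C !=set0 -> A `&` B `&` D !=set0.
Proof.
move=> sc cutA cutB maxC maxD ABC.
have [n [c [c0 <- maxc cardc]]] := sc _ _ maxC maxD.
(* The bound stays in the induction claim, since nothing is known of [c] beyond [n]. *)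
suff: forall i, (i <= n)%N -> A `&` B `&` c i !=set0 by apply.
elim=> [|i IHi] lt_in; first by rewrite c0.
apply: (common_point_step cutA cutB _ _ (cardc _ lt_in)).
- exact/maxc/ltnW.
- exact: maxc.
- exact/IHi/ltnW.
Qed.

(** The common point is carried from a maximal chain through [z] to one through [w], where it must
    be [w], the only point of [A] there. *)
Lemma meeting_cutsets_sub {A B} :
  strongly_connected P -> antichain_cutset A -> antichain_cutset B ->
  A `&` B !=set0 -> A `<=` B.
Proof.
move=> sc cutA cutB [z ABz] w Aw.
have [[C maxC Cz] [D maxD Dw]] := (exists_maximal_chain z, exists_maximal_chain w).
have [|u [[Au Bu] Du]] := common_point_transfer sc cutA cutB maxC maxD.
  by exists z.
by rewrite (antichain_cutset_uniq cutA maxD Aw Dw Au Du).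
Qed.

End CutsetsAlongChains.

Theorem theorem1p1 (d : Order.disp_t) (P : porderType d) (A B : set P) :
  strongly_connected P -> antichain_cutset A -> antichain_cutset B ->
  A <> B -> A `&` B = set0.
Proof.
move=> sc cutA cutB AB; apply: contrapT => /eqP/set0P AB0; apply: AB.
by apply/seteqP; split; apply: meeting_cutsets_sub => //; rewrite setIC.
Qed.
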